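(* For any type $A : \mathcal U$ and any $B : A \to \sqrt{}\,\mathcal U$ (in an arbitrary ambient context), there is an equivalence $$\Phi : \sqrt{}_{K}\Big(\prod_{h : \prod_{t:\mathbb T} A\langle t/K\rangle} \mathsf{ev}\big(i.\, B\langle i/K\rangle(h(i))\big)\Big) \;\longrightarrow\; \prod_{a:A} \sqrt{}_{L}\, \mathsf{ev}\big(i.\, B\langle i/L\rangle(a\langle i/L\rangle)\big)$$ given by $$\Phi :\equiv \lambda r.\,\lambda a.\,\mathsf{lock}_L.\ \mathsf{ev}\big(i.\, r\langle i/L\rangle\big)\big(\lambda t.\, a\langle t/L\rangle\big),\qquad \Phi^{-1} :\equiv \lambda f.\,\mathsf{lock}_K.\,\lambda h.\ \mathsf{ev}\big(k.\, f\langle k/K\rangle(h(k))\big).$$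
   Context: Ambient type theory: intensional Martin-Löf type theory with dependent products and sums (with definitional $\beta$ and $\eta$), identity types, and a hierarchy of universes written $\mathcal U$ (levels implicit). $\equiv$ is definitional equality. A vector such as $\vec t/L$ abbreviates a sequence $t_1/L_1,\dots,t_n/L_n$. The theory is extended as follows. (1) There is a closed type $\mathbb T$. (2) If $\Gamma$ is a context, so is $\Gamma,\mathsf{lock}_L$, where $L$ is a fresh lock name. (Binders extend the context on the right.) (3) Variables: if $L_1,\dots,L_n$ are the locks occurring (in order) in $\Gamma'$, and $\Gamma,x:A,\Gamma'\vdash t_m:\mathbb T$ for each $m$, then $\Gamma,x:A,\Gamma'\vdash x\langle \vec t/L\rangle : A[\vec t/\mathsf{key}_L]$. (With no locks this is the usual rule.) (4) Counit (admissible): from $\Gamma,\Gamma''\vdash a:A$ and a term $\Gamma,\Gamma'\vdash t_m:\mathbb T$ for each lock $L_m$ of $\Gamma'$, one gets $\Gamma,\Gamma',\Gamma''[\vec t/\mathsf{key}_L]\vdash a[\vec t/\mathsf{key}_L]:A[\vec t/\mathsf{key}_L]$. It commutes with all type and term formers; on variables, for $x$ in $\Gamma$ with $J$ the locks of $\Gamma$ after $x$ and $K$ the locks of $\Gamma''$, $x\langle \vec j/J,\vec k/K\rangle[\vec t/\mathsf{key}_L]:\equiv x\langle \vec j[\vec t/\mathsf{key}_L]/J,\ \vec t\,[\vec k[\vec t/\mathsf{key}_L]/\mathsf{key}_K]/L,\ \vec k[\vec t/\mathsf{key}_L]/K\rangle$; for $x$ in $\Gamma''$ (in particular bound), $x\langle\vec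 k/K\rangle[\vec t/\mathsf{key}_L]:\equiv x\langle\vec k[\vec t/\mathsf{key}_L]/K\rangle$. (5) Substitution: $(y\langle\vec t/L\rangle)[a/x]:\equiv y\langle\vec t[a/x]/L\rangle$ for $y\neq x$, and $(x\langle\vec t/L\rangle)[a/x]:\equiv a[\vec t[a/x]/\mathsf{key}_L]$. (6) Unit (admissible): from $\Gamma,i:\mathbb T,\mathsf{lock}_L,\Gamma'\vdash a:A$ one gets $\Gamma,\Gamma'[i./\mathsf{lock}_L]\vdash a[i./\mathsf{lock}_L]:A[i./\mathsf{lock}_L]$. It commutes with all formers; on variables, $i\langle t/L,\vec k/K\rangle\mapsto t[i./\mathsf{lock}_L]$; for $x$ in $\Gamma$, $x\langle\vec j/J,t/L,\vec k/K\rangle\mapsto x\langle\vec j[i./\mathsf{lock}_L]/J,\vec k[i./\mathsf{lock}_L]/K\rangle$; for $x$ in $\Gamma'$ or bound, $x\langle\vec k/K\rangle\mapsto x\langle\vec k[i./\mathsf{lock}_L]/K\rangle$. (7) Type former $\sqrt{}$ (right adjoint to $\mathsf{lock}$): if $\Gamma,\mathsf{lock}_L\vdash A:\mathcal U$ then $\Gamma\vdash\sqrt{}_L A:\mathcal U$; if $\Gamma,\mathsf{lock}_L\vdash a:A$ then $\Gamma\vdash \mathsf{lock}_L.\,a:\sqrt{}_L A$; if $\Gamma,i:\mathbb T\vdash r:\sqrt{}_L A$ then $\Gamma\vdash\mathsf{ev}(i.\,r):A[i./\mathsf{lock}_L]$ ($i$ bound in $r$). Computation: $\mathsf{ev}(i.\,\mathsf{lock}_L.\,a)\equiv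 a[i./\mathsf{lock}_L]$; $\eta$: $r\equiv\mathsf{lock}_L.\,\mathsf{ev}(i.\,r[i/\mathsf{key}_L])$. The lock name is omitted when unused (e.g. $\sqrt{}\,\mathcal U$). *)

(* Defs.v *)
From Stdlib Require Import List Arith.
Import ListNotations.

(** * Raw syntax

    Variables are de Bruijn indices that count variables only; locks are
    anonymous.  [Var x ks] is [x<t/L>]: [ks] has one key for every lock to the
    right of [x] in the context, innermost (rightmost) lock first.  Binding:
    [B] in [Pi A B], [Sig A B], [b] in [Lam b] and [r] in [Ev r] are under one
    more variable; [A] in [Sqrt A] and [a] in [Lock a] are under one more lock.
    The motive [C] of [J C d p] is a term of function type and binds nothing. *)
Inductive term : Type :=
| Var (x : nat) (ks : list term)
| Univ (i : nat)
| Pi (A B : term)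
| Lam (b : term)
| App (f a : term)
| Sig (A B : term)
| Pair (a b : term)
| Fst (p : term)
| Snd (p : term)
| Id (A a b : term)
| Refl (a : term)
| J (C d p : term)
| Tiny
| Sqrt (A : term)
| Lock (a : term)
| Ev (r : term).

(** * Operations on raw terms

    [traverse] commutes with all term formers: it processes the keys of each
    variable and hands the variable to [onvar], together with the numbers [m]
    and [l] of variables and locks to the right of the place in the context
    where the operation takes place (bound ones included).  It is used in the
    identity monad for total operations and in [option] for partial ones. *)
Fixpoint traverse {M : Type -> Type}
  (ret : forall X, X -> M X) (bind : forall X Y, M X -> (X -> M Y) -> M Y)
  (onvar : nat -> nat -> nat -> list term -> M term)
  (m l : nat) (a : term) {struct a} : M term :=
  let go := traverse ret bind onvar in
  let lift1 (c : term -> term) u := bind _ _ u (fun u' => ret _ (c u')) in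
  let lift2 (c : term -> term -> term) u v :=
    bind _ _ u (fun u' => bind _ _ v (fun v' => ret _ (c u' v'))) in
  let lift3 (c : term -> term -> term -> term) u v w :=
    bind _ _ u (fun u' => bind _ _ v (fun v' => bind _ _ w (fun w' =>
      ret _ (c u' v' w')))) in
  match a with
  | Var x ks =>
      bind _ _
        ((fix keys (ks : list term) : M (list term) :=
            match ks with
            | [] => ret _ []
            | k :: ks => bind _ _ (traverse ret bind onvar m l k) (fun k' =>
                         bind _ _ (keys ks) (fun ks' => ret _ (k' :: ks')))
            end) ks)
        (onvar m l x)
  | Univ i => ret _ (Univ i)
  | Pi A B => lift2 Pi (go m l A) (go (S m) l B)
  | Lam b => lift1 Lam (go (S m) l b)
  | App f a => lift2 App (go m l f) (go m l a)
  | Sig A B => lift2 Sig (go m l A) (go (S m) l B)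
  | Pair a b => lift2 Pair (go m l a) (go m l b)
  | Fst p => lift1 Fst (go m l p)
  | Snd p => lift1 Snd (go m l p)
  | Id A a b => lift3 Id (go m l A) (go m l a) (go m l b)
  | Refl a => lift1 Refl (go m l a)
  | J C d p => lift3 J (go m l C) (go m l d) (go m l p)
  | Tiny => ret _ Tiny
  | Sqrt A => lift1 Sqrt (go m (S l) A)
  | Lock a => lift1 Lock (go m (S l) a)
  | Ev r => lift1 Ev (go (S m) l r)
  end.

Definition traverse_id (onvar : nat -> nat -> nat -> list term -> term) :
    nat -> nat -> term -> term :=
  traverse (M := fun X => X) (fun _ x => x) (fun _ _ x f => f x) onvar.

Definition opt_bind (X Y : Type) (x : option X) (f : X -> option Y) : option Y :=
  match x with Some x => f x | None => None end.

Definition traverse_opt (onvar : nat -> nat -> nat -> list term -> option term) :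
    nat -> nat -> term -> option term :=
  traverse (@Some) opt_bind onvar.

Fixpoint map_opt {X Y : Type} (f : X -> option Y) (s : list X) : option (list Y) :=
  match s with
  | [] => Some []
  | x :: s => opt_bind _ _ (f x) (fun y =>
              opt_bind _ _ (map_opt f s) (fun ys => Some (y :: ys)))
  end.

(** Insertion of [n] variables and no lock. *)
Definition weaken_at (n : nat) : nat -> nat -> term -> term :=
  traverse_id (fun m _ x ks => Var (if x <? m then x else x + n) ks).

Definition weaken (n : nat) : term -> term := weaken_at n 0 0.

(** The counit [a[t/key_L]] from [Γ,Γ''] to [Γ,Γ',Γ''[t/key_L]]: [n] is the
    number of variables of [Γ'], [ts] the keys of the locks of [Γ'] (innermost
    first), and [m], [l] are the numbers of variables and locks of [Γ''].  A
    variable of [Γ] has keys [k] for the locks of [Γ''], followed by keys [j]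
    for those of [Γ]; the reparametrized keys [t[k/key_K]] go in between.

    The recursive calls on the [ts] are not on subterms, and the defining
    equations have no finite unfolding for some (even well-typed) [a] and [ts].
    Hence the bound [g] on the nesting of such calls: [None] means that [g] was
    too small. *)
Fixpoint counit (g n : nat) (ts : list term) (m l : nat) (a : term) :
    option term :=
  match g with
  | O => None
  | S g =>
      traverse_opt
        (fun m l x ks =>
           if x <? m then Some (Var x ks) else
           let k := firstn l ks in
           let j := skipn l ks in
           opt_bind _ _ (map_opt (counit g m k 0 0) ts) (fun ts' =>
             Some (Var (x + n) (k ++ ts' ++ j))))
        m l a
  end.

(** The substitution [b[s/x]] from [Γ,x:A,Γ'] to [Γ,Γ'[s/x]], where [Γ'] has
    [m] variables and [l] locks; the keys [ks] of [x] are the keys of the locks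
    of [Γ'], and [x<ks>] becomes [s[ks/key]]. *)
Definition subst (g : nat) (s : term) : nat -> nat -> term -> option term :=
  traverse_opt
    (fun m l x ks =>
       match x ?= m with
       | Lt => Some (Var x ks)
       | Eq => counit g m ks 0 0 s
       | Gt => Some (Var (x - 1) ks)
       end).

(** The unit [a[i./lock_L]] from [Γ,i:T,lock_L,Γ'] to [Γ,Γ'[i./lock_L]], where
    [Γ'] has [m] variables and [l] locks, so that the key of [lock_L] comes
    after [l] others.  The default of [nth] is never used on well-scoped
    terms. *)
Definition unit_op : nat -> nat -> term -> term :=
  traverse_id
    (fun m l x ks =>
       match x ?= m with
       | Lt => Var x ks
       | Eq => nth l ks Tiny
       | Gt => Var (x - 1) (firstn l ks ++ skipn (S l) ks)
       end).

(** The graphs of the operations, uniformly as relations; "[Counit n ts m l a b]"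
    reads "[a[t/key_L]] is defined and is [b]". *)
Definition Counit (n : nat) (ts : list term) (m l : nat) (a b : term) : Prop :=
  exists g, counit g n ts m l a = Some b.

Definition Subst (s : term) (m l : nat) (a b : term) : Prop :=
  exists g, subst g s m l a = Some b.

Definition Unit (m l : nat) (a b : term) : Prop := unit_op m l a = b.

(** * Contexts, the newest entry first *)
Inductive entry : Type :=
| Ext (A : term)
| Lk.

Definition ctx : Type := list entry.

Fixpoint vars (G : ctx) : nat :=
  match G with [] => 0 | Ext _ :: G => S (vars G) | Lk :: G => vars G end.

Fixpoint locks (G : ctx) : nat :=
  match G with [] => 0 | Ext _ :: G => locks G | Lk :: G => S (locks G) end.

Inductive ctx_op (op : nat -> nat -> term -> term -> Prop) : ctx -> ctx -> Prop :=
| ctx_op_nil : ctx_op op [] []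
| ctx_op_ext D D' A A' :
    ctx_op op D D' -> op (vars D) (locks D) A A' ->
    ctx_op op (Ext A :: D) (Ext A' :: D')
| ctx_op_lock D D' :
    ctx_op op D D' -> ctx_op op (Lk :: D) (Lk :: D').

(** * Judgements

    Universes are à la Russell, so a type is a term of some [Univ i], and
    equality of types is equality in [Univ i].  The structural rules (counit,
    substitution, unit), which are admissible, are included as rules. *)
Inductive wf : ctx -> Prop :=
| wf_nil : wf []
| wf_ext G A i : wf G -> has_type G A (Univ i) -> wf (Ext A :: G)
| wf_lock G : wf G -> wf (Lk :: G)

with has_type : ctx -> term -> term -> Prop :=
| t_var G D A ks A' :
    wf (D ++ Ext A :: G) ->
    length ks = locks D ->
    (forall t, In t ks -> has_type (D ++ Ext A :: G) t Tiny) ->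
    Counit (S (vars D)) ks 0 0 A A' ->
    has_type (D ++ Ext A :: G) (Var (vars D) ks) A'
| t_conv G a A B i :
    has_type G a A -> eq_term G A B (Univ i) -> has_type G a B
| t_univ G i : wf G -> has_type G (Univ i) (Univ (S i))
| t_pi G A B i j :
    has_type G A (Univ i) -> has_type (Ext A :: G) B (Univ j) ->
    has_type G (Pi A B) (Univ (Nat.max i j))
| t_lam G A B b i :
    has_type G A (Univ i) -> has_type (Ext A :: G) b B ->
    has_type G (Lam b) (Pi A B)
| t_app G A B f a B' :
    has_type G f (Pi A B) -> has_type G a A -> Subst a 0 0 B B' ->
    has_type G (App f a) B'
| t_sig G A B i j :
    has_type G A (Univ i) -> has_type (Ext A :: G) B (Univ j) ->
    has_type G (Sig A B) (Univ (Nat.max i j))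
| t_pair G A B a b B' j :
    has_type G a A -> has_type (Ext A :: G) B (Univ j) ->
    Subst a 0 0 B B' -> has_type G b B' ->
    has_type G (Pair a b) (Sig A B)
| t_fst G A B p : has_type G p (Sig A B) -> has_type G (Fst p) A
| t_snd G A B p B' :
    has_type G p (Sig A B) -> Subst (Fst p) 0 0 B B' ->
    has_type G (Snd p) B'
| t_id G A a b i :
    has_type G A (Univ i) -> has_type G a A -> has_type G b A ->
    has_type G (Id A a b) (Univ i)
| t_refl G A a : has_type G a A -> has_type G (Refl a) (Id A a a)
| t_J G A C a b d p j :
    has_type G C
      (Pi A (Pi (Id (weaken 1 A) (weaken 1 a) (Var 0 [])) (Univ j))) ->
    has_type G d (App (App C a) (Refl a)) ->
    has_type G b A -> has_type G p (Id A a b) ->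
    has_type G (J C d p) (App (App C b) p)
| t_tiny G : wf G -> has_type G Tiny (Univ 0)
| t_sqrt G A i : has_type (Lk :: G) A (Univ i) -> has_type G (Sqrt A) (Univ i)
| t_lock G A a : has_type (Lk :: G) a A -> has_type G (Lock a) (Sqrt A)
| t_ev G A r :
    has_type (Ext Tiny :: G) r (Sqrt A) -> has_type G (Ev r) (unit_op 0 0 A)
| t_counit G G' D D' ts a A a' A' :
    has_type (D ++ G) a A ->
    wf (G' ++ G) ->
    length ts = locks G' ->
    (forall t, In t ts -> has_type (G' ++ G) t Tiny) ->
    ctx_op (Counit (vars G') ts) D D' ->
    Counit (vars G') ts (vars D) (locks D) a a' ->
    Counit (vars G') ts (vars D) (locks D) A A' ->
    has_type (D' ++ G' ++ G) a' A'
| t_subst G D D' S s b B b' B' :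
    has_type (D ++ Ext S :: G) b B ->
    has_type G s S ->
    ctx_op (Subst s) D D' ->
    Subst s (vars D) (locks D) b b' ->
    Subst s (vars D) (locks D) B B' ->
    has_type (D' ++ G) b' B'
| t_unit G D D' a A :
    has_type (D ++ Lk :: Ext Tiny :: G) a A ->
    ctx_op Unit D D' ->
    has_type (D' ++ G)
      (unit_op (vars D) (locks D) a) (unit_op (vars D) (locks D) A)

with eq_term : ctx -> term -> term -> term -> Prop :=
| e_refl G a A : has_type G a A -> eq_term G a a A
| e_sym G a b A : eq_term G a b A -> eq_term G b a A
| e_trans G a b c A : eq_term G a b A -> eq_term G b c A -> eq_term G a c A
| e_conv G a b A B i :
    eq_term G a b A -> eq_term G A B (Univ i) -> eq_term G a b B
(* congruence *)
| e_var G D A ks ks' A' :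
    wf (D ++ Ext A :: G) ->
    length ks = locks D -> length ks' = locks D ->
    (forall t t', In (t, t') (combine ks ks') ->
       eq_term (D ++ Ext A :: G) t t' Tiny) ->
    Counit (S (vars D)) ks 0 0 A A' ->
    eq_term (D ++ Ext A :: G) (Var (vars D) ks) (Var (vars D) ks') A'
| e_pi G A A' B B' i j :
    has_type G A (Univ i) ->
    eq_term G A A' (Univ i) -> eq_term (Ext A :: G) B B' (Univ j) ->
    eq_term G (Pi A B) (Pi A' B') (Univ (Nat.max i j))
| e_lam G A B b b' i :
    has_type G A (Univ i) -> eq_term (Ext A :: G) b b' B ->
    eq_term G (Lam b) (Lam b') (Pi A B)
| e_app G A B f f' a a' B' :
    eq_term G f f' (Pi A B) -> eq_term G a a' A -> Subst a 0 0 B B' ->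
    eq_term G (App f a) (App f' a') B'
| e_sig G A A' B B' i j :
    has_type G A (Univ i) ->
    eq_term G A A' (Univ i) -> eq_term (Ext A :: G) B B' (Univ j) ->
    eq_term G (Sig A B) (Sig A' B') (Univ (Nat.max i j))
| e_pair G A B a a' b b' B' j :
    eq_term G a a' A -> has_type (Ext A :: G) B (Univ j) ->
    Subst a 0 0 B B' -> eq_term G b b' B' ->
    eq_term G (Pair a b) (Pair a' b') (Sig A B)
| e_fst G A B p p' : eq_term G p p' (Sig A B) -> eq_term G (Fst p) (Fst p') A
| e_snd G A B p p' B' :
    eq_term G p p' (Sig A B) -> Subst (Fst p) 0 0 B B' ->
    eq_term G (Snd p) (Snd p') B'
| e_id G A A' a a' b b' i :
    eq_term G A A' (Univ i) -> eq_term G a a' A -> eq_term G b b' A ->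
    eq_term G (Id A a b) (Id A' a' b') (Univ i)
| e_refl_cong G A a a' :
    eq_term G a a' A -> eq_term G (Refl a) (Refl a') (Id A a a)
| e_J G A C C' a b d d' p p' j :
    eq_term G C C'
      (Pi A (Pi (Id (weaken 1 A) (weaken 1 a) (Var 0 [])) (Univ j))) ->
    eq_term G d d' (App (App C a) (Refl a)) ->
    has_type G b A -> eq_term G p p' (Id A a b) ->
    eq_term G (J C d p) (J C' d' p') (App (App C b) p)
| e_sqrt G A A' i :
    eq_term (Lk :: G) A A' (Univ i) -> eq_term G (Sqrt A) (Sqrt A') (Univ i)
| e_lock G A a a' :
    eq_term (Lk :: G) a a' A -> eq_term G (Lock a) (Lock a') (Sqrt A)
| e_ev G A r r' :
    eq_term (Ext Tiny :: G) r r' (Sqrt A) ->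
    eq_term G (Ev r) (Ev r') (unit_op 0 0 A)
(* computation and uniqueness *)
| e_pi_beta G A B b a b' B' i :
    has_type G A (Univ i) -> has_type (Ext A :: G) b B -> has_type G a A ->
    Subst a 0 0 b b' -> Subst a 0 0 B B' ->
    eq_term G (App (Lam b) a) b' B'
| e_pi_eta G A B f :
    has_type G f (Pi A B) ->
    eq_term G f (Lam (App (weaken 1 f) (Var 0 []))) (Pi A B)
| e_fst_beta G A B a b B' j :
    has_type G a A -> has_type (Ext A :: G) B (Univ j) ->
    Subst a 0 0 B B' -> has_type G b B' ->
    eq_term G (Fst (Pair a b)) a A
| e_snd_beta G A B a b B' j :
    has_type G a A -> has_type (Ext A :: G) B (Univ j) ->
    Subst a 0 0 B B' -> has_type G b B' ->
    eq_term G (Snd (Pair a b)) b B'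
| e_sig_eta G A B p :
    has_type G p (Sig A B) ->
    eq_term G p (Pair (Fst p) (Snd p)) (Sig A B)
| e_J_beta G A C a d j :
    has_type G C
      (Pi A (Pi (Id (weaken 1 A) (weaken 1 a) (Var 0 [])) (Univ j))) ->
    has_type G d (App (App C a) (Refl a)) ->
    has_type G a A ->
    eq_term G (J C d (Refl a)) d (App (App C a) (Refl a))
| e_sqrt_beta G A a :
    has_type (Lk :: Ext Tiny :: G) a A ->
    eq_term G (Ev (Lock a)) (unit_op 0 0 a) (unit_op 0 0 A)
| e_sqrt_eta G A r r' :
    has_type G r (Sqrt A) ->
    Counit 1 [Var 0 []] 0 0 r r' ->
    eq_term G r (Lock (Ev r')) (Sqrt A)
(* structural rules *)
| e_counit G G' D D' ts a b A a' b' A' :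
    eq_term (D ++ G) a b A ->
    wf (G' ++ G) ->
    length ts = locks G' ->
    (forall t, In t ts -> has_type (G' ++ G) t Tiny) ->
    ctx_op (Counit (vars G') ts) D D' ->
    Counit (vars G') ts (vars D) (locks D) a a' ->
    Counit (vars G') ts (vars D) (locks D) b b' ->
    Counit (vars G') ts (vars D) (locks D) A A' ->
    eq_term (D' ++ G' ++ G) a' b' A'
| e_subst G D D' S s a b B a' b' B' :
    eq_term (D ++ Ext S :: G) a b B ->
    has_type G s S ->
    ctx_op (Subst s) D D' ->
    Subst s (vars D) (locks D) a a' ->
    Subst s (vars D) (locks D) b b' ->
    Subst s (vars D) (locks D) B B' ->
    eq_term (D' ++ G) a' b' B'
| e_unit G D D' a b A :
    eq_term (D ++ Lk :: Ext Tiny :: G) a b A ->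
    ctx_op Unit D D' ->
    eq_term (D' ++ G)
      (unit_op (vars D) (locks D) a) (unit_op (vars D) (locks D) b)
      (unit_op (vars D) (locks D) A).

(** * Equivalences *)
Definition Arr (A B : term) : term := Pi A (weaken 1 B).

Definition Prod (A B : term) : term := Sig A (weaken 1 B).

(** [Σ (g : Y → X), Π (y : Y), f (g y) = y]. *)
Definition RInv (X Y f : term) : term :=
  Sig (Arr Y X)
    (Pi (weaken 1 Y)
      (Id (weaken 2 Y) (App (weaken 2 f) (App (Var 1 []) (Var 0 []))) (Var 0 []))).

(** [Σ (h : Y → X), Π (x : X), h (f x) = x]. *)
Definition LInv (X Y f : term) : term :=
  Sig (Arr Y X)
    (Pi (weaken 1 X)
      (Id (weaken 2 X) (App (Var 1 []) (App (weaken 2 f) (Var 0 []))) (Var 0 []))).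

Definition IsEquiv (X Y f : term) : term := Prod (RInv X Y f) (LInv X Y f).

(** * The types and maps of the statement *)

(** [√_K (Π (h : Π (t : T), AK), ev (i. BK (h i)))], where [AK] is [A<t/K>] and
    [BK] is [B<i/K>]. *)
Definition SqrtPi (AK BK : term) : term :=
  Sqrt (Pi (Pi Tiny AK) (Ev (App BK (App (Var 1 []) (Var 0 []))))).

(** [Π (a : A), √_L ev (i. BL (a<i/L>))], where [BL] is [B<i/L>]. *)
Definition PiSqrt (A BL : term) : term :=
  Pi A (Sqrt (Ev (App BL (Var 1 [Var 0 []])))).

(** [λr. λa. lock_L. ev (i. r<i/L>) (λt. a<t/L>)]. *)
Definition Phi : term :=
  Lam (Lam (Lock (App (Ev (Var 2 [Var 0 []])) (Lam (Var 1 [Var 0 []]))))).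

(** [λf. lock_K. λh. ev (k. f<k/K> (h k))]. *)
Definition PhiInv : term :=
  Lam (Lock (Lam (Ev (App (Var 2 [Var 0 []]) (App (Var 1 []) (Var 0 [])))))).

(* Main.v *)
Require Import Defs.
From Stdlib Require Import List Arith Lia.
Import ListNotations.

(** The theorem is proved for two variables [A : U_i] and [B : A -> sqrt U_j]
    on top of [G] and transported to arbitrary [A] and [B] by the substitution
    rule.  For variables, all operations on raw terms that occur in the
    derivations are computations on closed syntax.  The instantiation of a
    variable [A<t/K>] is by definition the counit [A[t/key_K]], so all that is
    left for arbitrary [A] and [B] is that this counit is total for the empty key
    list and for a single variable as key, and that it commutes with weakening.

    In the generic context, [Phi] and [PhiInv] are inverse to each other
    judgmentally, by [beta] and [eta] for [Pi] and [Sqrt], so that [Refl] proves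
    both homotopies. *)

(** * Operations on raw terms *)

(** The generated principle has no induction hypothesis for the keys of [Var]; hence
    [Forall P ks]. *)
Lemma term_nested_ind (P : term -> Prop)
  (HVar : forall x ks, Forall P ks -> P (Var x ks))
  (HUniv : forall i, P (Univ i))
  (HPi : forall A B, P A -> P B -> P (Pi A B))
  (HLam : forall b, P b -> P (Lam b))
  (HApp : forall f a, P f -> P a -> P (App f a))
  (HSig : forall A B, P A -> P B -> P (Sig A B))
  (HPair : forall a b, P a -> P b -> P (Pair a b))
  (HFst : forall p, P p -> P (Fst p))
  (HSnd : forall p, P p -> P (Snd p))
  (HId : forall A a b, P A -> P a -> P b -> P (Id A a b))
  (HRefl : forall a, P a -> P (Refl a))
  (HJ : forall C d p, P C -> P d -> P p -> P (J C d p))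
  (HTiny : P Tiny)
  (HSqrt : forall A, P A -> P (Sqrt A))
  (HLock : forall a, P a -> P (Lock a))
  (HEv : forall r, P r -> P (Ev r))
  (a : term) : P a.
Proof.
  revert a. fix rec 1. intros [].
  { apply HVar. induction ks as [|k ks IH]; constructor; [apply rec | exact IH]. }
  all: first [apply HUniv | apply HPi | apply HLam | apply HApp | apply HSig | apply HPair
    | apply HFst | apply HSnd | apply HId | apply HRefl | apply HJ | apply HTiny
    | apply HSqrt | apply HLock | apply HEv]; apply rec.
Qed.

Lemma traverse_id_var g m l x ks :
  traverse_id g m l (Var x ks) = g m l x (map (traverse_id g m l) ks).
Proof. reflexivity. Qed.

Lemma traverse_opt_var f m l x ks :
  traverse_opt f m l (Var x ks) =
  opt_bind _ _ (map_opt (traverse_opt f m l) ks) (f m l x).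
Proof.
  unfold traverse_opt; cbn. f_equal.
  induction ks as [|k ks IH]; cbn; [|rewrite IH]; reflexivity.
Qed.

(** Fusion: both traversals commute with all formers, so their composite is settled at variables.
    The second operation takes place [m] variables and [l] locks further left than the first. *)
Lemma traverse_opt_id f g h m l :
  (forall p q x ks ks',
     map_opt (traverse_opt f (p + m) (q + l)) ks = Some ks' ->
     traverse_opt f (p + m) (q + l) (g p q x ks) = Some (h p q x ks')) ->
  forall a p q,
    traverse_opt f (p + m) (q + l) (traverse_id g p q a) = Some (traverse_id h p q a).
Proof.
  intros H a. induction a as [x ks IH| | | | | | | | | | | | | | |] using term_nested_ind;
    intros p q.
  1: { rewrite !traverse_id_var. apply H.
    induction IH as [|k ks Hk _ IH]; cbn [map map_opt]; [reflexivity|].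
    rewrite Hk, IH. reflexivity. }
  all: repeat match goal with IH : forall p q, _ = Some _ |- _ =>
      pose proof (IH p q); pose proof (IH (S p) q); pose proof (IH p (S q)); clear IH end.
  all: unfold traverse_opt, traverse_id in *; cbn in *.
  all: repeat match goal with E : _ = Some _ |- _ => try rewrite E; clear E end.
  all: reflexivity.
Qed.

Lemma traverse_id_Var : forall a p q, traverse_id (fun _ _ => Var) p q a = a.
Proof.
  intro a. induction a as [x ks IH| | | | | | | | | | | | | | |] using term_nested_ind;
    intros p q.
  1: { rewrite traverse_id_var. f_equal.
    induction IH as [|k ks Hk _ IH]; cbn [map]; [|rewrite Hk, IH]; reflexivity. }
  all: unfold traverse_id in *; cbn; congruence.
Qed.

Lemma traverse_opt_Some f h a p q :
  (forall m l x ks, f m l x ks = Some (h m l x ks)) ->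
  traverse_opt f p q a = Some (traverse_id h p q a).
Proof.
  intro H. rewrite <- (traverse_id_Var a p q) at 1.
  rewrite <- (Nat.add_0_r p) at 1. rewrite <- (Nat.add_0_r q) at 1.
  apply traverse_opt_id. intros m l x ks ks' Hk.
  rewrite traverse_opt_var, Hk. cbn [opt_bind].
  rewrite H, !Nat.add_0_r. reflexivity.
Qed.

Lemma map_opt_firstn {T U} (f : T -> option U) n s t :
  map_opt f s = Some t -> map_opt f (firstn n s) = Some (firstn n t).
Proof.
  revert n t; induction s as [|x s IH]; intros n t; cbn.
  - intros [= <-]. now rewrite !firstn_nil.
  - destruct (f x) as [y|] eqn:E; [|discriminate]. cbn.
    destruct (map_opt f s) as [ys|]; [|discriminate]. cbn. intros [= <-].
    destruct n as [|n]; [reflexivity|]. cbn. now rewrite E, (IH n ys).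
Qed.

Lemma map_opt_skipn {T U} (f : T -> option U) n s t :
  map_opt f s = Some t -> map_opt f (skipn n s) = Some (skipn n t).
Proof.
  revert n t; induction s as [|x s IH]; intros n t; cbn.
  - intros [= <-]. now rewrite !skipn_nil.
  - destruct (f x) as [y|] eqn:E; [|discriminate]. cbn.
    destruct (map_opt f s) as [ys|] eqn:Es; [|discriminate]. cbn. intros [= <-].
    destruct n as [|n]; cbn; [now rewrite E, Es | now apply IH].
Qed.

Lemma map_opt_app {T U} (f : T -> option U) s s' t t' :
  map_opt f s = Some t -> map_opt f s' = Some t' ->
  map_opt f (s ++ s') = Some (t ++ t').
Proof.
  intros Hs Hs'. revert t Hs; induction s as [|x s IH]; intros t; cbn.
  - intros [= <-]. exact Hs'.
  - destruct (f x) as [y|]; [|discriminate]. cbn.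
    destruct (map_opt f s) as [ys|]; [|discriminate]. cbn. intros [= <-].
    now rewrite (IH ys).
Qed.

(** The counit along [n] variables and one lock whose key is the newest of these
    variables. *)
Definition with_key (n : nat) : term -> term :=
  traverse_id (fun m l x ks =>
    if x <? m then Var x ks
    else Var (x + n) (firstn l ks ++ Var m (firstn l ks) :: skipn l ks)) 0 0.

Lemma counit_S g n ts m l a :
  counit (S g) n ts m l a =
  traverse_opt
    (fun m l x ks =>
       if x <? m then Some (Var x ks) else
       opt_bind _ _ (map_opt (counit g m (firstn l ks) 0 0) ts) (fun ts' =>
         Some (Var (x + n) (firstn l ks ++ ts' ++ skipn l ks))))
    m l a.
Proof. reflexivity. Qed.

Lemma counit_nil g n a : counit (S g) n [] 0 0 a = Some (weaken n a).
Proof.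
  rewrite counit_S. apply traverse_opt_Some. intros p q x ks.
  destruct (x <? p); [reflexivity|]. cbn.
  now rewrite firstn_skipn.
Qed.

(** The counit with no new variables and no keys is both [weaken 0 a] and the identity traversal. *)
Lemma weaken_0 a : weaken 0 a = a.
Proof.
  enough (Some (weaken 0 a) = Some a) by congruence.
  rewrite <- (traverse_id_Var a 0 0) at 2.
  rewrite <- (counit_nil 0), counit_S. apply traverse_opt_Some. intros p q x ks.
  destruct (x <? p); [reflexivity|]. cbn.
  now rewrite firstn_skipn, Nat.add_0_r.
Qed.

(** This is the recursive call of [counit] on the key [Var 0 []]; the keys it receives undergo only
    [weaken 0]. *)
Lemma counit_new_var g n ks : counit (S (S g)) n ks 0 0 (Var 0 []) = Some (Var n ks).
Proof.
  rewrite counit_S, traverse_opt_var. cbn [map_opt opt_bind Nat.ltb Nat.leb firstn skipn].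
  replace (map_opt (counit (S g) 0 [] 0 0) ks) with (Some ks).
  { cbn. now rewrite app_nil_r. }
  induction ks as [|k ks IH]; [reflexivity|].
  cbn [map_opt]. now rewrite counit_nil, weaken_0, <- IH.
Qed.

(** Three levels suffice: one for [a], one for the key, one for the keys that the key receives. *)
Lemma counit_key g n a :
  counit (S (S (S g))) n [Var 0 []] 0 0 a = Some (with_key n a).
Proof.
  rewrite counit_S. apply traverse_opt_Some. intros p q x ks.
  destruct (x <? p); [reflexivity|].
  cbn [map_opt]. now rewrite counit_new_var.
Qed.

(** The new variables to the left of position [m] include the key and stay fixed;
    hence [0 < m]. *)
Lemma traverse_opt_with_key f n n' m l a :
  0 < m ->
  (forall p q x ks, x < p + m -> f (p + m) (q + l) x ks = Some (Var x ks)) ->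
  (forall p q x ks, p <= x -> f (p + m) (q + l) (x + n) ks = Some (Var (x + n') ks)) ->
  traverse_opt f m l (with_key n a) = Some (with_key n' a).
Proof.
  intros Hm Hlt Hge. refine (traverse_opt_id f _ _ m l _ a 0 0).
  intros p q x ks ks' Hk.
  destruct (Nat.ltb_spec x p) as [Hx|Hx]; rewrite traverse_opt_var.
  - rewrite Hk. apply Hlt. lia.
  - erewrite map_opt_app; [apply Hge; exact Hx | apply map_opt_firstn, Hk |].
    cbn [map_opt]. rewrite traverse_opt_var, (map_opt_firstn _ _ _ _ Hk).
    cbn [opt_bind]. rewrite Hlt by lia. cbn [opt_bind].
    now rewrite (map_opt_skipn _ _ _ _ Hk).
Qed.

Lemma traverse_opt_weaken f n n' m l a :
  (forall p q x ks, x < p -> f (p + m) (q + l) x ks = Some (Var x ks)) ->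
  (forall p q x ks, p <= x -> f (p + m) (q + l) (x + n) ks = Some (Var (x + n') ks)) ->
  traverse_opt f m l (weaken n a) = Some (weaken n' a).
Proof.
  intros Hlt Hge. refine (traverse_opt_id f _ _ m l _ a 0 0).
  intros p q x ks ks' Hk. rewrite traverse_opt_var, Hk.
  cbn [opt_bind]. destruct (Nat.ltb_spec x p); [apply Hlt | apply Hge]; assumption.
Qed.

Lemma weaken_at_Some n m l a b :
  traverse_opt (fun m _ x ks => Some (Var (if x <? m then x else x + n) ks)) m l a
    = Some b ->
  weaken_at n m l a = b.
Proof.
  erewrite traverse_opt_Some by reflexivity. intros [= <-]. reflexivity.
Qed.

(** The position [m] lies inside the inserted block, to the left of its key, so the block grows by
    [k]. *)
Lemma weaken_at_with_key k m l n a :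
  0 < m <= n -> weaken_at k m l (with_key n a) = with_key (n + k) a.
Proof.
  intros. apply weaken_at_Some, traverse_opt_with_key; [lia | ..]; intros p q x ks Hx;
    repeat f_equal; destruct (Nat.ltb_spec x (p + m)), (Nat.ltb_spec (x + n) (p + m)); lia.
Qed.

Lemma weaken_at_weaken k m l n a :
  m <= n -> weaken_at k m l (weaken n a) = weaken (n + k) a.
Proof.
  intros. apply weaken_at_Some, traverse_opt_weaken; intros p q x ks Hx;
    repeat f_equal; destruct (Nat.ltb_spec x (p + m)), (Nat.ltb_spec (x + n) (p + m)); lia.
Qed.

(** The replaced variable belongs to the inserted block and, as [0 < n], is not the key. So it does
    not occur, and the block loses one variable. *)
Lemma subst_with_key g s n l a :
  0 < n -> subst g s n l (with_key (S n) a) = Some (with_key n a).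
Proof.
  intros. apply traverse_opt_with_key; [lia | ..]; intros p q x ks Hx.
  - now rewrite (proj2 (Nat.compare_lt_iff _ _)).
  - rewrite (proj2 (Nat.compare_gt_iff _ _)) by lia. do 2 f_equal; lia.
Qed.

Lemma subst_weaken g s n l a : subst g s n l (weaken (S n) a) = Some (weaken n a).
Proof.
  intros. apply traverse_opt_weaken; intros p q x ks Hx.
  - now rewrite (proj2 (Nat.compare_lt_iff _ _)) by lia.
  - rewrite (proj2 (Nat.compare_gt_iff _ _)) by lia. do 2 f_equal; lia.
Qed.

(** * Typing rules with explicit computations *)

Lemma wf_tail e G : wf (e :: G) -> wf G.
Proof. intro H; inversion H; assumption. Qed.

(** The decomposition that [t_var] asks for is found by evaluation instead of unification modulo
    [++]. *)
Fixpoint split_ctx (x : nat) (G : ctx) : option (ctx * term * ctx) :=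
  match G with
  | [] => None
  | Lk :: G => opt_bind _ _ (split_ctx x G) (fun '(D, A, G0) => Some (Lk :: D, A, G0))
  | Ext T :: G =>
      match x with
      | 0 => Some ([], T, G)
      | S x => opt_bind _ _ (split_ctx x G) (fun '(D, A, G0) => Some (Ext T :: D, A, G0))
      end
  end.

Lemma split_ctx_sound x G D A G0 :
  split_ctx x G = Some (D, A, G0) -> G = D ++ Ext A :: G0 /\ vars D = x.
Proof.
  revert x D; induction G as [|[T|] G IH]; intros x D; simpl.
  - discriminate.
  - destruct x as [|x].
    + intros [= <- <- <-]; auto.
    + destruct (split_ctx x G) as [[[D1 A1] G1]|] eqn:E; simpl; [|discriminate].
      intros [= <- -> ->]; destruct (IH _ _ E) as [-> <-]; auto.
  - destruct (split_ctx x G) as [[[D1 A1] G1]|] eqn:E; simpl; [|discriminate].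
    intros [= <- -> ->]; destruct (IH _ _ E) as [-> <-]; auto.
Qed.

Lemma ty_var G x ks D A G0 A' :
  split_ctx x G = Some (D, A, G0) -> wf G -> length ks = locks D ->
  Forall (fun t => has_type G t Tiny) ks -> Counit (S x) ks 0 0 A A' ->
  has_type G (Var x ks) A'.
Proof.
  intros [-> <-]%split_ctx_sound Hw Hl Hk HC.
  eapply t_var; eauto. now apply Forall_forall.
Qed.

(** In this and the following variants, premises in an extended context may assume that it is
    well-formed, so that [assumption] closes the [wf] conditions. *)
Lemma ty_pi G A B i j k :
  wf G -> has_type G A (Univ i) ->
  (wf (Ext A :: G) -> has_type (Ext A :: G) B (Univ j)) ->
  Nat.max i j = k -> has_type G (Pi A B) (Univ k).
Proof. intros Hw HA HB <-; eapply t_pi; eauto using wf_ext. Qed.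

Lemma ty_lam G A B b i :
  wf G -> has_type G A (Univ i) ->
  (wf (Ext A :: G) -> has_type (Ext A :: G) b B) -> has_type G (Lam b) (Pi A B).
Proof. intros; eapply t_lam; eauto using wf_ext. Qed.

Lemma ty_sqrt G A i :
  wf G -> (wf (Lk :: G) -> has_type (Lk :: G) A (Univ i)) ->
  has_type G (Sqrt A) (Univ i).
Proof. intros; apply t_sqrt; eauto using wf_lock. Qed.

Lemma ty_lock G A a :
  wf G -> (wf (Lk :: G) -> has_type (Lk :: G) a A) -> has_type G (Lock a) (Sqrt A).
Proof. intros; apply t_lock; eauto using wf_lock. Qed.

Lemma ty_ev G A r A' :
  wf G -> (wf (Ext Tiny :: G) -> has_type (Ext Tiny :: G) r (Sqrt A)) ->
  unit_op 0 0 A = A' -> has_type G (Ev r) A'.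
Proof. intros Hw Hr <-; apply t_ev, Hr; eauto using wf_ext, t_tiny. Qed.

(** The generic terms are concrete syntax, so evaluation yields the result; [12] is just a large
    enough nesting bound. *)
Ltac comp := lazymatch goal with
  | |- Counit _ _ _ _ _ _ => exists 12; lazy; reflexivity
  | |- Subst _ _ _ _ _ => exists 12; lazy; reflexivity
  | |- unit_op _ _ _ = _ => lazy; reflexivity
  | |- ctx_op _ _ _ => repeat constructor; try comp
  end.

(** Syntax-directed and without [t_conv]: [Phi], whose typing involves a conversion, needs lemmas of
    its own. *)
Ltac ty :=
  lazymatch goal with
  | |- has_type _ ?t _ =>
    let t' := eval hnf in t in
    lazymatch t' with
    | Var _ _ => eapply ty_var; [lazy; reflexivity | assumption | reflexivity
                  | repeat first [apply Forall_nil | apply Forall_cons; [ty|]] | comp]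
    | Univ _ => apply t_univ; assumption
    | Tiny => apply t_tiny; assumption
    | Pi _ _ => eapply ty_pi; [assumption | ty | intro; ty | first [reflexivity | lia]]
    | Lam _ => eapply ty_lam; [assumption | ty | intro; ty]
    | App _ _ => eapply t_app; [ty | ty | comp]
    | Sqrt _ => eapply ty_sqrt; [assumption | intro; ty]
    | Lock _ => eapply ty_lock; [assumption | intro; ty]
    | Ev _ => eapply ty_ev; [assumption | intro; ty | comp]
    end
  end.

Lemma eq_beta G A B b a b' B' i :
  wf G -> has_type G A (Univ i) -> (wf (Ext A :: G) -> has_type (Ext A :: G) b B) ->
  has_type G a A -> Subst a 0 0 b b' -> Subst a 0 0 B B' ->
  eq_term G (App (Lam b) a) b' B'.
Proof. intros; eapply e_pi_beta; eauto using wf_ext. Qed.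

Lemma eq_lam G A B b b' i :
  wf G -> has_type G A (Univ i) ->
  (wf (Ext A :: G) -> eq_term (Ext A :: G) b b' B) ->
  eq_term G (Lam b) (Lam b') (Pi A B).
Proof. intros; eapply e_lam; eauto using wf_ext. Qed.

Lemma eq_lock G A a a' :
  wf G -> (wf (Lk :: G) -> eq_term (Lk :: G) a a' A) ->
  eq_term G (Lock a) (Lock a') (Sqrt A).
Proof. intros; apply e_lock; eauto using wf_lock. Qed.

Lemma eq_ev G A r r' A' :
  wf G -> (wf (Ext Tiny :: G) -> eq_term (Ext Tiny :: G) r r' (Sqrt A)) ->
  unit_op 0 0 A = A' -> eq_term G (Ev r) (Ev r') A'.
Proof. intros Hw Hr <-; apply e_ev, Hr; eauto using wf_ext, t_tiny. Qed.

Lemma eq_sqrt_beta G A a a' A' :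
  wf G -> (wf (Lk :: Ext Tiny :: G) -> has_type (Lk :: Ext Tiny :: G) a A) ->
  unit_op 0 0 a = a' -> unit_op 0 0 A = A' -> eq_term G (Ev (Lock a)) a' A'.
Proof.
  intros Hw Ha <- <-; apply e_sqrt_beta, Ha; eapply wf_lock, wf_ext, t_tiny; eassumption.
Qed.

Ltac beta_red A := eapply (eq_beta _ A); [assumption | ty | intro; ty | ty | comp | comp].

Ltac ev_cong tac := eapply eq_ev; [assumption | intro; tac | comp].
Ltac app_cong tac1 tac2 := eapply e_app; [tac1 | tac2 | comp].

(** * The equivalence for two variables *)

(** Here [A] is [Var 1 []] and [B] is [Var 0 []]. In [dom], [A] occurs under one binder and [B]
    under two, so both get the index [2 + n]. *)
Definition Gen (i j : nat) (G : ctx) : ctx :=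
  Ext (Pi (Var 0 []) (Sqrt (Univ j))) :: Ext (Univ i) :: G.

(** The domain and the codomain of [Phi] for the variables [A] and [B], weakened to
    [n] further variables. *)
Definition dom (n : nat) : term :=
  SqrtPi (Var (2 + n) [Var 0 []]) (Var (2 + n) [Var 0 []]).
Definition cod (n : nat) : term :=
  PiSqrt (Var (1 + n) []) (Var (2 + n) [Var 0 []]).

Lemma wf_Gen i j G : wf G -> wf (Gen i j G).
Proof.
  intro hG. assert (wf (Ext (Univ i) :: G)) by (eapply wf_ext; [|ty]; auto).
  unfold Gen. eapply wf_ext; auto. ty.
Qed.

Lemma ty_dom i j G : wf (Gen i j G) -> has_type (Gen i j G) (dom 0) (Univ (Nat.max i j)).
Proof. intro. ty. Qed.

Lemma ty_cod i j G : wf (Gen i j G) -> has_type (Gen i j G) (cod 0) (Univ (Nat.max i j)).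
Proof. intro. ty. Qed.

Lemma ty_PhiInv i j G : wf (Gen i j G) -> has_type (Gen i j G) PhiInv (Arr (cod 0) (dom 0)).
Proof. intro. ty. Qed.

(** The body of [Phi] has the required type only up to this [beta] in the
    argument of [B]. *)
Lemma ev_beta_conv i j G T :
  wf (Lk :: Ext (Var 2 []) :: Ext T :: Gen i j G) ->
  eq_term (Lk :: Ext (Var 2 []) :: Ext T :: Gen i j G)
   (Ev (App (Var 3 [Var 0 []]) (App (Lam (Var 2 [Var 0 []])) (Var 0 []))))
   (Ev (App (Var 3 [Var 0 []]) (Var 1 [Var 0 []]))) (Univ j).
Proof.
  intros. ev_cong ltac:(app_cong ltac:(apply e_refl; ty) ltac:(beta_red Tiny)).
Qed.

Lemma ty_Phi_body i j G :
  wf (Lk :: Ext (Var 2 []) :: Ext (dom 0) :: Gen i j G) ->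
  has_type (Lk :: Ext (Var 2 []) :: Ext (dom 0) :: Gen i j G)
    (App (Ev (Var 2 [Var 0 []])) (Lam (Var 1 [Var 0 []])))
    (Ev (App (Var 3 [Var 0 []]) (Var 1 [Var 0 []]))).
Proof. intro. eapply t_conv; [ty | apply ev_beta_conv; assumption]. Qed.

(** The beta rule for [Phi] asks for the type of this body in larger contexts, where it is obtained
    from here by counit. *)
Lemma ty_Phi_inner i j G : wf (Ext (dom 0) :: Gen i j G) ->
  has_type (Ext (dom 0) :: Gen i j G)
    (Lam (Lock (App (Ev (Var 2 [Var 0 []])) (Lam (Var 1 [Var 0 []]))))) (cod 1).
Proof.
  intro. eapply ty_lam; [assumption | ty | intro].
  eapply ty_lock; [assumption | intro].
  apply ty_Phi_body; assumption.
Qed.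

Lemma ty_Phi i j G : wf (Gen i j G) -> has_type (Gen i j G) Phi (Arr (dom 0) (cod 0)).
Proof.
  intro. eapply ty_lam; [assumption | ty | intro].
  apply ty_Phi_inner; assumption.
Qed.

Ltac keys := intros ? HIn; repeat destruct HIn as [<- | HIn]; [.. | destruct HIn]; ty.

Lemma Phi_app i j G : wf (Ext (dom 0) :: Gen i j G) ->
  eq_term (Ext (dom 0) :: Gen i j G) (App Phi (Var 0 []))
    (Lam (Lock (App (Ev (Var 2 [Var 0 []])) (Lam (Var 1 [Var 0 []]))))) (cod 1).
Proof.
  intro. eapply (eq_beta _ (dom 1) (cod 2)); [assumption | ty | intro | ty | comp | comp].
  (* A counit without keys is weakening, here to the left of the variable bound by [Phi]. *)
  refine (t_counit (Gen i j G) [Ext (dom 0)] [Ext (dom 0)] [Ext (dom 1)] [] _ (cod 1) _ _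
    _ _ _ _ _ _ _);
  [ apply ty_Phi_inner; assumption | assumption | reflexivity | keys | comp | comp | comp].
Qed.

Lemma Phi_app2 i j G : wf (Ext (Var 2 []) :: Ext (dom 0) :: Gen i j G) ->
  eq_term (Ext (Var 2 []) :: Ext (dom 0) :: Gen i j G)
    (App (App Phi (Var 1 [])) (Var 0 []))
    (Lock (App (Ev (Var 2 [Var 0 []])) (Lam (Var 1 [Var 0 []]))))
    (Sqrt (Ev (App (Var 3 [Var 0 []]) (Var 1 [Var 0 []])))).
Proof.
  intro H.
  assert (wf (Ext (dom 0) :: Gen i j G)) by (apply wf_tail in H; assumption).
  eapply e_trans.
  - app_cong ltac:(refine (e_counit _ [Ext (Var 2 [])] [] [] [] _ _ (cod 1) _ _ _
       (Phi_app i j G _) _ _ _ _ _ _ _);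
       [assumption | assumption | reflexivity | keys | comp ..])
     ltac:(apply e_refl; ty).
  - eapply (eq_beta _ (Var 3 []) (Sqrt (Ev (App (Var 4 [Var 0 []]) (Var 1 [Var 0 []])))));
      [assumption | ty | intro | ty | comp | comp].
    refine (t_counit (Ext (dom 0) :: Gen i j G) [Ext (Var 2 [])] [Ext (Var 2 [])]
      [Ext (Var 3 [])] [] (Lock (App (Ev (Var 2 [Var 0 []])) (Lam (Var 1 [Var 0 []]))))
      (Sqrt (Ev (App (Var 3 [Var 0 []]) (Var 1 [Var 0 []])))) _ _ _ _ _ _ _ _ _);
    [ eapply ty_lock; [assumption | intro; apply ty_Phi_body; assumption]
    | assumption | reflexivity | keys | comp ..].
Qed.

(** The redex [Phi r<k/K> (h k)] inside [PhiInv (Phi r)]. It is transported from [Phi_app2], so that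
    the body of [Phi] need not be retyped behind the lock. *)
Lemma Phi_app2_key i j G :
  wf (Ext Tiny :: Ext (Pi Tiny (Var 3 [Var 0 []])) :: Lk :: Ext (dom 0) :: Gen i j G) ->
  eq_term (Ext Tiny :: Ext (Pi Tiny (Var 3 [Var 0 []])) :: Lk :: Ext (dom 0) :: Gen i j G)
    (App (App Phi (Var 2 [Var 0 []])) (App (Var 1 []) (Var 0 [])))
    (Lock (App (Ev (Var 3 [Var 0 []; Var 1 [Var 0 []]]))
               (Lam (App (Var 2 [Var 0 []]) (Var 1 [Var 0 []])))))
    (Sqrt (Ev (App (Var 4 [Var 0 []; Var 1 [Var 0 []]])
                   (App (Var 2 [Var 0 []]) (Var 1 [Var 0 []]))))).
Proof.
  intro H.
  assert (wf (Ext (dom 0) :: Gen i j G)).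
  { do 3 apply wf_tail in H. exact H. }
  assert (wf (Ext (Var 2 []) :: Ext (dom 0) :: Gen i j G)) by (eapply wf_ext; [assumption | ty]).
  (* Backwards: [h k] replaces the variable [a] after the counit has inserted [k], [h] and the lock,
     with key [k]. *)
  refine (e_subst _ [] [] (Var 4 [Var 0 []]) (App (Var 1 []) (Var 0 []))
    (App (App Phi (Var 3 [Var 1 []])) (Var 0 []))
    (Lock (App (Ev (Var 4 [Var 0 []; Var 2 [Var 0 []]])) (Lam (Var 1 [Var 0 []]))))
    (Sqrt (Ev (App (Var 5 [Var 0 []; Var 2 [Var 0 []]]) (Var 1 [Var 0 []]))))
    _ _ _ _ _ _ _ _ _); [ | ty | comp ..].
  refine (e_counit (Ext (dom 0) :: Gen i j G)
      [Ext Tiny; Ext (Pi Tiny (Var 3 [Var 0 []])); Lk]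
      [Ext (Var 2 [])] [Ext (Var 4 [Var 0 []])] [Var 0 []] _ _ _ _ _ _
      (Phi_app2 i j G _) _ _ _ _ _ _ _);
   [assumption | assumption | reflexivity | keys | comp ..].
Qed.

Lemma PhiInv_Phi i j G : wf (Ext (dom 0) :: Gen i j G) ->
  eq_term (Ext (dom 0) :: Gen i j G) (App PhiInv (App Phi (Var 0 []))) (Var 0 []) (dom 1).
Proof.
  intro H.
  assert (wf (Gen i j G)) by (apply wf_tail in H; assumption).
  eapply e_trans.
  { eapply (eq_beta _ (cod 1) (dom 2)); [assumption | ty | intro; ty | | comp | comp].
    eapply t_app.
    - refine (t_counit (Gen i j G) [Ext (dom 0)] [] [] [] _ (Arr (dom 0) (cod 0)) _ _
        (ty_Phi i j G _) _ _ _ _ _ _);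
      [assumption | assumption | reflexivity | keys | comp ..].
    - ty.
    - comp. }
  (* Eta for [Sqrt], then for [Pi], expands the right-hand side, so that both sides are compared
     under [lock_K] and [h]. *)
  eapply e_trans; [ | eapply e_sym, e_sqrt_eta; [ty | comp]].
  eapply eq_lock; [assumption | intro].
  eapply e_trans; [ | eapply e_sym, e_pi_eta; ty].
  eapply eq_lam; [assumption | ty | intro].
  eapply e_trans.
  { ev_cong ltac:(apply Phi_app2_key; assumption). }
  eapply e_trans.
  (* The type found for the contractum mentions [(λt. h t) i]; beta in the argument of [B] turns
     this into [h i]. *)
  - eapply e_conv.
    + eapply eq_sqrt_beta; [assumption | intro; ty | comp | comp].
    + ev_cong ltac:(app_cong ltac:(apply e_refl; ty) ltac:(beta_red Tiny)).
  (* Only eta for [h] remains; after [e_sym] the type is computed from [h] itself. *)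
  - eapply e_sym. app_cong ltac:(apply e_refl; ty) ltac:(eapply e_pi_eta; ty).
Qed.

(** Unlike [Phi], [PhiInv] is within reach of [ty], so beta applies directly behind the lock. *)
Lemma PhiInv_app_key i j G :
  wf (Ext Tiny :: Lk :: Ext (Var 2 []) :: Ext (cod 0) :: Gen i j G) ->
  eq_term (Ext Tiny :: Lk :: Ext (Var 2 []) :: Ext (cod 0) :: Gen i j G)
    (App PhiInv (Var 2 [Var 0 []]))
    (Lock (Lam (Ev (App (Var 4 [Var 0 []; Var 2 [Var 0 []]]) (App (Var 1 []) (Var 0 []))))))
    (SqrtPi (Var 5 [Var 0 []; Var 1 [Var 0 []]])
       (Var 5 [Var 0 []; Var 2 [Var 0 []]])).
Proof.
  intro. eapply (eq_beta _ (PiSqrt (Var 4 [Var 0 []]) (Var 5 [Var 0 []; Var 2 [Var 0 []]]))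
   (SqrtPi (Var 6 [Var 0 []; Var 2 [Var 0 []]])
       (Var 6 [Var 0 []; Var 3 [Var 0 []]]))); [assumption | ty | intro; ty | ty | comp | comp].
Qed.

Lemma Phi_PhiInv i j G : wf (Ext (cod 0) :: Gen i j G) ->
  eq_term (Ext (cod 0) :: Gen i j G) (App Phi (App PhiInv (Var 0 []))) (Var 0 []) (cod 1).
Proof.
  intro H.
  assert (wf (Gen i j G)) by (apply wf_tail in H; assumption).
  eapply e_trans.
  { eapply (eq_beta _ (dom 1) (cod 2));
      [assumption | ty | intro | apply (t_app _ (cod 1) (dom 2)); [ty | ty | comp] | comp | comp].
    refine (t_counit (Gen i j G) [Ext (cod 0)] [Ext (dom 0)] [Ext (dom 1)] [] _ (cod 1) _ _
      (ty_Phi_inner i j G _) _ _ _ _ _ _);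
    [eapply wf_ext; [assumption | ty] | assumption | reflexivity | keys | comp ..]. }
  eapply e_trans; [ | eapply e_sym, e_pi_eta; ty].
  eapply eq_lam; [assumption | ty | intro].
  eapply e_trans; [ | eapply e_sym, e_sqrt_eta; [ty | comp]].
  eapply eq_lock; [assumption | intro].
  eapply e_conv; [ | apply ev_beta_conv; assumption].
  eapply e_trans.
  { app_cong ltac:(eapply e_trans;
        [ ev_cong ltac:(apply PhiInv_app_key; assumption)
        | eapply (eq_sqrt_beta _
            (Pi (Pi Tiny (Var 5 [Var 0 []; Var 1 [Var 0 []]]))
                (Ev (App (Var 5 [Var 0 []; Var 2 [Var 0 []]])
                         (App (Var 1 []) (Var 0 []))))));
          [assumption | intro; ty | comp | comp] ])
      ltac:(apply e_refl; ty). }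
  (* Two beta steps are left: one for [h], and one for [(λt. a<t/L>) k] in the argument of [f]. *)
  eapply e_trans.
  - beta_red (Pi Tiny (Var 4 [Var 0 []])).
  - ev_cong ltac:(app_cong ltac:(apply e_refl; ty) ltac:(beta_red Tiny)).
Qed.

(** The two arbitrary entries cover the contexts of both homotopies. *)
Lemma ty_Phi_weaken2 i j G S T :
  wf (Ext S :: Ext T :: Gen i j G) ->
  has_type (Ext S :: Ext T :: Gen i j G) Phi (Arr (dom 2) (cod 2)).
Proof.
  intro H.
  assert (wf (Gen i j G)) by (do 2 apply wf_tail in H; exact H).
  refine (t_counit (Gen i j G) [Ext S; Ext T] [] [] [] Phi (Arr (dom 0) (cod 0)) _ _
      (ty_Phi i j G _) _ _ _ _ _ _);
    [assumption | assumption | reflexivity | intros ? [] | comp ..].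
Qed.

Lemma ty_RInv_body i j G : wf (Gen i j G) -> exists k,
  has_type (Ext (Arr (cod 0) (dom 0)) :: Gen i j G)
    (Pi (cod 1) (Id (cod 2) (App Phi (App (Var 1 []) (Var 0 []))) (Var 0 []))) (Univ k).
Proof.
  intro. assert (wf (Ext (Arr (cod 0) (dom 0)) :: Gen i j G)) by (eapply wf_ext; [assumption | ty]).
  eexists. eapply ty_pi; [assumption | ty | intro | reflexivity].
  eapply t_id; [ty | | ty].
  eapply (t_app _ (dom 2) (cod 3)); [ | ty | comp].
  apply ty_Phi_weaken2; assumption.
Qed.

Lemma ty_LInv_body i j G : wf (Gen i j G) -> exists k,
  has_type (Ext (Arr (cod 0) (dom 0)) :: Gen i j G)
    (Pi (dom 1) (Id (dom 2) (App (Var 1 []) (App Phi (Var 0 []))) (Var 0 []))) (Univ k).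
Proof.
  intro. assert (wf (Ext (Arr (cod 0) (dom 0)) :: Gen i j G)) by (eapply wf_ext; [assumption | ty]).
  eexists. eapply ty_pi; [assumption | ty | intro | reflexivity].
  eapply t_id; [ty | | ty].
  eapply t_app; [ty | | comp].
  eapply (t_app _ (dom 2) (cod 3)); [ | ty | comp].
  apply ty_Phi_weaken2; assumption.
Qed.

Definition refl_htpy : term := Lam (Refl (Var 0 [])).

Lemma ty_equiv i j G : wf (Gen i j G) ->
  has_type (Gen i j G) (Pair (Pair PhiInv refl_htpy) (Pair PhiInv refl_htpy))
    (IsEquiv (dom 0) (cod 0) Phi).
Proof.
  intro.
  assert (wf (Ext (cod 0) :: Gen i j G)) by (eapply wf_ext; [assumption | ty]).
  assert (wf (Ext (dom 0) :: Gen i j G)) by (eapply wf_ext; [assumption | ty]).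
  destruct (ty_RInv_body i j G) as [k Hk]; [assumption|].
  destruct (ty_LInv_body i j G) as [k' Hk']; [assumption|].
  assert (has_type (Gen i j G) (Arr (cod 0) (dom 0)) (Univ (Nat.max (Nat.max i j) (Nat.max i j))))
   by ty.
  eapply t_pair.
  - eapply t_pair; [apply ty_PhiInv; assumption | exact Hk | comp |].
    eapply ty_lam; [assumption | ty | intro].
    (* [Refl] is a loop at the variable; judgmental equality replaces its left endpoint by the
       composite. *)
    eapply t_conv; [eapply t_refl; ty |].
    eapply e_id; [apply e_refl; ty | | apply e_refl; ty].
    apply e_sym, Phi_PhiInv; assumption.
  (* The second factor of [Prod] is weakened by the first, so its typing is a counit of that of
     [LInv]. *)
  - refine (t_counit (Gen i j G) [Ext _] [] [] [] (LInv (dom 0) (cod 0) Phi) (Univ _) _ _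
      _ _ _ _ _ _ _); [ | | reflexivity | intros ? [] | comp ..].
    + eapply t_sig; [eassumption | exact Hk'].
    + eapply wf_ext; [assumption | eapply t_sig; [eassumption | exact Hk]].
  - comp.
  - eapply t_pair; [apply ty_PhiInv; assumption | exact Hk' | comp |].
    eapply ty_lam; [assumption | ty | intro].
    eapply t_conv; [eapply t_refl; ty |].
    eapply e_id; [apply e_refl; ty | | apply e_refl; ty].
    apply e_sym, PhiInv_Phi; assumption.
Qed.

(** * Instantiation *)

(** [b] is [a] with [A] and then [B] substituted for the last two variables of
    the generic context, below [m] variables and [l] locks.  The bound [3] is what
    [counit] needs for the keys [[]] and [[Var 0 []]]. *)
Definition Inst (A B : term) (m l : nat) (a b : term) : Prop :=
  exists c, subst 3 A (S m) l a = Some c /\ subst 3 B m l c = Some b.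

Lemma Inst_closed A B m l a :
  subst 3 A (S m) l a = Some a -> subst 3 B m l a = Some a -> Inst A B m l a a.
Proof. exists a; auto. Qed.

(** Substituting [A] weakens it past the bound variables and the variable for [B]; substituting [B]
    removes the latter. *)
Lemma Inst_fst A B m l : Inst A B m l (Var (S m) []) (weaken m A).
Proof.
  exists (weaken (S m) A). split; [|apply subst_weaken].
  unfold subst. rewrite traverse_opt_var. cbn [map_opt opt_bind].
  rewrite Nat.compare_refl. apply counit_nil.
Qed.

(** [0 < m] ensures that the key [Var 0 []] is a bound variable and not the one for [B]. *)
Lemma Inst_fst_key A B m l : 0 < m -> Inst A B m l (Var (S m) [Var 0 []]) (with_key m A).
Proof.
  intro. exists (with_key (S m) A). split; [|now apply subst_with_key].
  destruct m as [|m]; [lia|].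
  unfold subst. rewrite traverse_opt_var. cbn [map_opt opt_bind].
  rewrite traverse_opt_var. cbn [map_opt opt_bind Nat.compare].
  rewrite Nat.compare_refl. apply counit_key.
Qed.

Lemma Inst_snd_key A B m l : 0 < m -> Inst A B m l (Var m [Var 0 []]) (with_key m B).
Proof.
  intro. exists (Var m [Var 0 []]).
  destruct m as [|m]; [lia|]. split.
  - unfold subst. rewrite traverse_opt_var. cbn [map_opt opt_bind].
    rewrite traverse_opt_var. cbn [map_opt opt_bind Nat.compare].
    now rewrite (proj2 (Nat.compare_lt_iff _ _)) by lia.
  - unfold subst. rewrite traverse_opt_var. cbn [map_opt opt_bind].
    rewrite traverse_opt_var. cbn [map_opt opt_bind Nat.compare].
    rewrite Nat.compare_refl. apply counit_key.
Qed.

Ltac compute_subst := unfold subst, traverse_opt in *; cbn -[counit];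
  repeat match goal with E : traverse _ _ _ _ _ _ = Some _ |- _ =>
    try rewrite E; clear E; cbn -[counit] end; reflexivity.

Ltac inst := intros;
  repeat match goal with H : Inst _ _ _ _ _ _ |- _ => destruct H as (? & ? & ?) end;
  eexists; split; [compute_subst | compute_subst].

Lemma Inst_Pi A B m l C D C' D' :
  Inst A B m l C C' -> Inst A B (S m) l D D' -> Inst A B m l (Pi C D) (Pi C' D').
Proof. inst. Qed.

Lemma Inst_Sig A B m l C D C' D' :
  Inst A B m l C C' -> Inst A B (S m) l D D' -> Inst A B m l (Sig C D) (Sig C' D').
Proof. inst. Qed.

Lemma Inst_App A B m l f a f' a' :
  Inst A B m l f f' -> Inst A B m l a a' -> Inst A B m l (App f a) (App f' a').
Proof. inst. Qed.

Lemma Inst_Id A B m l C a b C' a' b' :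
  Inst A B m l C C' -> Inst A B m l a a' -> Inst A B m l b b' ->
  Inst A B m l (Id C a b) (Id C' a' b').
Proof. inst. Qed.

Lemma Inst_Sqrt A B m l C C' : Inst A B m (S l) C C' -> Inst A B m l (Sqrt C) (Sqrt C').
Proof. inst. Qed.

Lemma Inst_Ev A B m l r r' : Inst A B (S m) l r r' -> Inst A B m l (Ev r) (Ev r').
Proof. inst. Qed.

Ltac instantiate_terms :=
  lazymatch goal with
  | |- Inst _ _ _ _ (Pi _ _) _ => eapply Inst_Pi; instantiate_terms
  | |- Inst _ _ _ _ (Sig _ _) _ => eapply Inst_Sig; instantiate_terms
  | |- Inst _ _ _ _ (Id _ _ _) _ => eapply Inst_Id; instantiate_terms
  | |- Inst _ _ _ _ (App _ _) _ => eapply Inst_App; instantiate_terms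
  | |- Inst _ _ _ _ (Sqrt _) _ => eapply Inst_Sqrt; instantiate_terms
  | |- Inst _ _ _ _ (Ev _) _ => eapply Inst_Ev; instantiate_terms
  | |- _ => first [apply Inst_closed; reflexivity | apply Inst_fst
      | apply Inst_fst_key; lia | apply Inst_snd_key; lia]
  end.

Lemma Inst_eq A B m l a b c : Inst A B m l a b -> b = c -> Inst A B m l a c.
Proof. intros H <-. exact H. Qed.

(** Rewriting with these equations pushes weakening down to [A] and [B] and leaves it folded
    there. *)
Lemma weaken_at_Pi n m l C D :
  weaken_at n m l (Pi C D) = Pi (weaken_at n m l C) (weaken_at n (S m) l D).
Proof. reflexivity. Qed.

Lemma weaken_at_Sig n m l C D :
  weaken_at n m l (Sig C D) = Sig (weaken_at n m l C) (weaken_at n (S m) l D).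
Proof. reflexivity. Qed.

Lemma weaken_at_Id n m l C a b :
  weaken_at n m l (Id C a b) = Id (weaken_at n m l C) (weaken_at n m l a) (weaken_at n m l b).
Proof. reflexivity. Qed.

Lemma weaken_at_App n m l f a :
  weaken_at n m l (App f a) = App (weaken_at n m l f) (weaken_at n m l a).
Proof. reflexivity. Qed.

Lemma weaken_at_Sqrt n m l C : weaken_at n m l (Sqrt C) = Sqrt (weaken_at n m (S l) C).
Proof. reflexivity. Qed.

Lemma weaken_at_Ev n m l r : weaken_at n m l (Ev r) = Ev (weaken_at n (S m) l r).
Proof. reflexivity. Qed.

Definition domAt (A B : term) : term := SqrtPi (with_key 1 A) (with_key 2 B).
Definition codAt (A B : term) : term := PiSqrt A (with_key 2 B).

Ltac solve_inst :=
  lazymatch goal with |- Inst ?A ?B ?m ?l ?t ?u =>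
    let t' := eval lazy in t in change (Inst A B m l t' u) end;
  eapply Inst_eq; [instantiate_terms |];
  unfold domAt, codAt, IsEquiv, Prod, RInv, LInv, Arr, SqrtPi, PiSqrt, weaken;
  repeat first [rewrite weaken_at_Pi | rewrite weaken_at_Sig | rewrite weaken_at_Id
    | rewrite weaken_at_App | rewrite weaken_at_Sqrt | rewrite weaken_at_Ev];
  repeat change (weaken_at ?n 0 0 ?a) with (weaken n a);
  rewrite ?weaken_at_weaken, ?weaken_at_with_key, ?weaken_0 by lia;
  try reflexivity.

Lemma Inst_dom A B : Inst A B 0 0 (dom 0) (domAt A B).
Proof. solve_inst. Qed.

Lemma Inst_cod A B : Inst A B 0 0 (cod 0) (codAt A B).
Proof. solve_inst. Qed.

Lemma Inst_Phi A B : Inst A B 0 0 (Arr (dom 0) (cod 0)) (Arr (domAt A B) (codAt A B)).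
Proof. solve_inst. Qed.

Lemma Inst_PhiInv A B : Inst A B 0 0 (Arr (cod 0) (dom 0)) (Arr (codAt A B) (domAt A B)).
Proof. solve_inst. Qed.

Lemma Inst_IsEquiv A B :
  Inst A B 0 0 (IsEquiv (dom 0) (cod 0) Phi) (IsEquiv (domAt A B) (codAt A B) Phi).
Proof. solve_inst. Qed.

Lemma Inst_has_type i j G A B t T t' T' :
  has_type G A (Univ i) -> has_type G B (Arr A (Sqrt (Univ j))) ->
  has_type (Gen i j G) t T -> Inst A B 0 0 t t' -> Inst A B 0 0 T T' ->
  has_type G t' T'.
Proof.
  intros hA hB ht (u & Hu & Ht') (U & HU & HT').
  apply (t_subst G [] [] (Arr A (Sqrt (Univ j))) B u U); [ | exact hB | constructor
    | exists 3; exact Ht' | exists 3; exact HT'].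
  (* [A] is substituted to the left of the variable for [B], whose declared type thereby becomes
     [Arr A (Sqrt (Univ j))]. *)
  apply (t_subst G [Ext (Pi (Var 0 []) (Sqrt (Univ j)))] [Ext (Arr A (Sqrt (Univ j)))]
    (Univ i) A t T); [exact ht | exact hA | | exists 3; exact Hu | exists 3; exact HU].
  constructor; [constructor |]. exists 3. unfold subst, traverse_opt. cbn -[counit].
  now rewrite counit_nil, weaken_0.
Qed.

Theorem proposition3p14 (G : ctx) (i j : nat) (A B : term)
    (hG : wf G)
    (hA : has_type G A (Univ i))
    (hB : has_type G B (Arr A (Sqrt (Univ j)))) :
  exists AK BK BL : term,
    (* [A<t/K>] in [G, lock_K, t : T] *)
    Counit (vars [Ext Tiny; Lk]) [Var 0 []] 0 0 A AK /\
    (* [B<i/K>] in [G, lock_K, h : Pi (t : T), A<t/K>, i : T] *)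
    Counit (vars [Ext Tiny; Ext (Pi Tiny AK); Lk]) [Var 0 []] 0 0 B BK /\
    (* [B<i/L>] in [G, a : A, lock_L, i : T] *)
    Counit (vars [Ext Tiny; Lk; Ext A]) [Var 0 []] 0 0 B BL /\
    has_type G (SqrtPi AK BK) (Univ (Nat.max i j)) /\
    has_type G (PiSqrt A BL) (Univ (Nat.max i j)) /\
    has_type G Phi (Arr (SqrtPi AK BK) (PiSqrt A BL)) /\
    has_type G PhiInv (Arr (PiSqrt A BL) (SqrtPi AK BK)) /\
    exists e1 e2 : term,
      has_type G (Pair (Pair PhiInv e1) (Pair PhiInv e2))
        (IsEquiv (SqrtPi AK BK) (PiSqrt A BL) Phi).
Proof.
  pose proof (wf_Gen i j G hG) as hGen.
  (* Each counit has the newest variable as its only key; the inserted variables are [t], then [h]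
     and [i], then [a] and [i]. *)
  exists (with_key 1 A), (with_key 2 B), (with_key 2 B).
  repeat split; [exists 3; apply counit_key .. | | | | |].
  - refine (Inst_has_type _ _ _ _ _ _ _ _ _ hA hB (ty_dom i j G hGen) (Inst_dom A B) _).
    apply Inst_closed; reflexivity.
  - refine (Inst_has_type _ _ _ _ _ _ _ _ _ hA hB (ty_cod i j G hGen) (Inst_cod A B) _).
    apply Inst_closed; reflexivity.
  - refine (Inst_has_type _ _ _ _ _ _ _ _ _ hA hB (ty_Phi i j G hGen) _ (Inst_Phi A B)).
    apply Inst_closed; reflexivity.
  - refine (Inst_has_type _ _ _ _ _ _ _ _ _ hA hB (ty_PhiInv i j G hGen) _ (Inst_PhiInv A B)).
    apply Inst_closed; reflexivity.
  - exists refl_htpy, refl_htpy.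
    refine (Inst_has_type _ _ _ _ _ _ _ _ _ hA hB (ty_equiv i j G hGen) _ (Inst_IsEquiv A B)).
    apply Inst_closed; reflexivity.
Qed.
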